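(* Let $\mathcal{X},\mathcal{Y}$ be Euclidean spaces, $\mathcal Z=\mathcal X\times\mathcal Y$, and let $f,g,f_2,g_2,A$ satisfy the problem assumptions of the context, with $L_{\nabla f_2},L_{\nabla g_2}\ge 0$ Lipschitz constants of $\nabla f_2,\nabla g_2$. Assume that the weak Minty variational inequality holds with parameter $\rho\in\mathbb{R}$ and nonempty set $S_\star$ (see context), and let $z_*=(x_*,y_* )\in S_\star$. Let $\gamma_x,\gamma_y>0$, $0<\alpha\le 1$, put $\underline{\gamma}=\min(\gamma_x,\gamma_y)$ and $$C=\alpha\left(\frac{\underline{\gamma}(1-\alpha)}{2}+\rho\right),$$ and assume $$\alpha<1+\frac{2\rho}{\underline{\gamma}},\qquad \gamma_y\le\frac{1}{\sqrt{2}\,L_{\nabla g_2}},\qquad 2\gamma_x\gamma_y\|A\|^2+\gamma_x^2L_{\nabla f_2}^2\le 1 .$$ Let $z_0=(x_0,y_0)\in\mathcal Z$ be arbitrary and let $(\hat y_{k+1},\bar y_{k+1},\hat x_{k+1},\bar x_{k+1},x_{k+1},y_{k+1})_{k\ge0}$ be any sequence generated by the NC-PDHG algorithm (see context) with parameters $\gamma_x,\gamma_y,\alpha$. Let $\bar D_{k+1}=(\bar F_{k+1},\bar G_{k+1})$ with $$\bar F_{k+1}=\frac1{\gamma_x}(\hat x_{k+1}-\bar x_{k+1})+\nabla f_2(\bar x_{k+1})+A^\top\bar y_{k+1},\qquad \bar G_{k+1}=\frac1{\gamma_y}(\hat y_{k+1}-\bar y_{k+1})+\nabla g_2(\bar y_{k+1})-A\bar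 x_{k+1}.$$ Then for every integer $K\ge1$, $$\sum_{k=0}^{K-1}\|\bar D_{k+1}\|_{\mathcal Z}^2\le\frac{\|z_0-z_*\|^2_{\gamma^{-1}\mathcal Z}}{2C},$$ where $\|(x,y)\|^2_{\gamma^{-1}\mathcal Z}=\frac1{\gamma_x}\|x\|_{\mathcal X}^2+\frac1{\gamma_y}\|y\|_{\mathcal Y}^2$.
   Context: Norms: $\|(x,y)\|_{\mathcal Z}^2=\|x\|_{\mathcal X}^2+\|y\|_{\mathcal Y}^2$ with Euclidean norms on $\mathcal X,\mathcal Y$; $\|A\|$ is the operator norm. If $L_{\nabla g_2}=0$, the condition $\gamma_y\le 1/(\sqrt2 L_{\nabla g_2})$ is void. Problem. $\min_{x\in\mathcal X}\max_{y\in\mathcal Y}\mathcal L(x,y)=f(x)+f_2(x)+\langle Ax,y\rangle-g_2(y)-g(y)$. Problem assumptions. $f:\mathcal X\to\mathbb R\cup\{+\infty\}$ and $g:\mathcal Y\to\mathbb R\cup\{+\infty\}$ are possibly nonconvex and ''proximal-friendly'', i.e. proper, lower semicontinuous, with the proximal sets used by the algorithm nonempty; $A:\mathcal X\to\mathcal Y$ is linear; $f_2:\mathcal X\to\mathbb R$, $g_2:\mathcal Y\to\mathbb R$ are possibly nonconvex, differentiable, and $\|\nabla f_2(x_1)-\nabla f_2(x_2)\|\le L_{\nabla f_2}\|x_1-x_2\|$, $\|\nabla g_2(y_1)-\nabla g_2(y_2)\|\le L_{\nabla g_2}\|y_1-y_2\|$ for all $x_1,x_2\in\mathcal X$, $y_1,y_2\in\mathcal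 Y$. Proximal operator (set-valued). For $s>0$, $\mathrm{Prox}_{s,h}(u)=\arg\min_{u'}\, h(u')+\frac1{2s}\|u'-u\|^2$. Clarke subdifferential. For a nonempty closed set $S$ and $x\in S$, a nonzero vector $v$ is perpendicular to $S$ at $x$ if $v=x'-x$ for some $x'\notin S$ whose unique closest point in $S$ is $x$. The Clarke normal cone $\mathcal N_S(x)$ is the closed convex hull of the set consisting of $0$ and all vectors $\lambda\lim_i v_i/|v_i|$ with $\lambda\ge0$, $v_i$ perpendicular to $S$ at $x_i\in S$, $x_i\to x$, $v_i\to0$. For $h$ finite at $x$, $\partial_Ch(x)=\{\xi:(\xi,-1)\in\mathcal N_{\mathrm{epi}\,h}(x,h(x))\}$ where $\mathrm{epi}\,h=\{(x,t):h(x)\le t\}$; $\partial_C h(x)=\emptyset$ if $h(x)=+\infty$. Weak Minty variational inequality. Define the set-valued saddle operator $$T(x,y)=\big(\partial_Cf(x)+\nabla f_2(x)+A^\top y\big)\times\big(\partial_Cg(y)+\nabla g_2(y)-Ax\big).$$ A stationary point is $z_*$ with $0\in T(z_* )$. The assumption: there are $\rho\in\mathbb R$ (possibly negative) and a nonempty set $S_\star$ of stationary points such that for all $z_\star\in S_\star$, $\langle v,z-z_\star\rangle\ge\rho\|v\|^2$ for all $z\in\mathcal Z$ and all $v\in T(z)$. NC-PDHG algorithm. Given $(x_0,y_0)$, for $k\ge0$: $\hat y_{k+1}=y_k+\gamma_y(Ax_k-\nabla g_2(y_k))$; $\bar y_{k+1}\in\mathrm{Prox}_{\gamma_y,g}(\hat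 y_{k+1})$; $\hat x_{k+1}=x_k-\gamma_x(\nabla f_2(x_k)+A^\top\bar y_{k+1})$; $\bar x_{k+1}\in\mathrm{Prox}_{\gamma_x,f}(\hat x_{k+1})$; $x_{k+1}=x_k+\alpha\big(\bar x_{k+1}-\hat x_{k+1}-\gamma_x(\nabla f_2(\bar x_{k+1})+A^\top\bar y_{k+1})\big)$; $y_{k+1}=y_k+\alpha\big(\bar y_{k+1}-\hat y_{k+1}+\gamma_y(A\bar x_{k+1}-\nabla g_2(\bar y_{k+1}))\big)$. *)

(* Defs.v *)
From HB Require Import structures.
From mathcomp Require Import all_boot all_order all_algebra.
From mathcomp Require Import all_classical all_reals all_analysis.

Set Implicit Arguments.
Unset Strict Implicit.
Unset Printing Implicit Defensive.

Import Order.TTheory GRing.Theory Num.Theory.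
Import numFieldNormedType.Exports.

Local Open Scope classical_set_scope.
Local Open Scope ring_scope.

(* The Euclidean spaces X and Y are R^n and R^m, as column vectors.  The norm
   [`|_|] of the library on matrices is the sup norm: it is used here only
   through the topology and the differential it induces, which do not depend on
   the choice of the norm; every metric quantity goes through [enorm] below. *)

Definition dotv (R : realType) (n : nat) (u v : 'cV[R]_n) : R :=
  \sum_(i < n) u i 0 * v i 0.

Definition enorm (R : realType) (n : nat) (u : 'cV[R]_n) : R :=
  Num.sqrt (dotv u u).

Definition dotZ (R : realType) (n m : nat) (z w : 'cV[R]_n * 'cV[R]_m) : R :=
  dotv z.1 w.1 + dotv z.2 w.2.

Definition normZ (R : realType) (n m : nat) (z : 'cV[R]_n * 'cV[R]_m) : R :=
  Num.sqrt (enorm z.1 ^+ 2 + enorm z.2 ^+ 2).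

(* The square of the norm weighted by gamma^-1, not the norm itself. *)
Definition sqnormZ_inv (R : realType) (n m : nat) (gx gy : R)
    (z : 'cV[R]_n * 'cV[R]_m) : R :=
  gx^-1 * enorm z.1 ^+ 2 + gy^-1 * enorm z.2 ^+ 2.

Definition opnorm (R : realType) (n m : nat) (A : 'M[R]_(m, n)) : R :=
  sup [set enorm (A *m u) | u in [set u : 'cV[R]_n | enorm u <= 1]].

(* Meaningful when h is differentiable at x, in which case
   [dotv (gradient h x) v = 'd h x v]. *)
Definition gradient (R : realType) (n : nat) (h : 'cV[R]_n -> R)
    (x : 'cV[R]_n) : 'cV[R]_n :=
  \col_(i < n) 'd h x (delta_mx i 0).

Definition elipschitz (R : realType) (n m : nat) (L : R)
    (F : 'cV[R]_n -> 'cV[R]_m) : Prop :=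
  forall u v, enorm (F u - F v) <= L * enorm (u - v).

(* The first clause restricts the values of h to R \cup {+oo}. *)
Definition proper_function (R : realType) (T : Type) (h : T -> \bar R) : Prop :=
  (forall u, h u != -oo%E) /\ (exists u, h u != +oo%E).

Definition argmin (R : realType) (T : Type) (h : T -> \bar R) : set T :=
  [set u | forall v, (h u <= h v)%E].

Definition prox (R : realType) (n : nat) (s : R) (h : 'cV[R]_n -> \bar R)
    (u : 'cV[R]_n) : set 'cV[R]_n :=
  argmin (fun u' => (h u' + ((2 * s)^-1 * enorm (u' - u) ^+ 2)%:E)%E).

Definition perpendicular (R : realType) (d : nat) (S : set 'cV[R]_d)
    (x v : 'cV[R]_d) : Prop :=
  v != 0 /\
  exists x' : 'cV[R]_d,
    [/\ ~ S x', v = x' - x, S x &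
        forall s, S s -> s != x -> enorm (x' - x) < enorm (x' - s)].

Definition perp_directions (R : realType) (d : nat) (S : set 'cV[R]_d)
    (x : 'cV[R]_d) : set 'cV[R]_d :=
  [set w | exists (lambda : R) (l : 'cV[R]_d) (x_ v_ : nat -> 'cV[R]_d),
     [/\ 0 <= lambda /\ w = lambda *: l,
         forall i, S (x_ i) /\ perpendicular S (x_ i) (v_ i),
         x_ @ \oo --> x,
         v_ @ \oo --> (0 : 'cV[R]_d) &
         (fun i => (enorm (v_ i))^-1 *: v_ i) @ \oo --> l]].

Definition closed_convex_hull (R : realType) (d : nat) (B : set 'cV[R]_d) :
    set 'cV[R]_d :=
  closure (smallest (fun M : set 'cV[R]_d => convex_set M) B).

Definition clarke_normal_cone (R : realType) (d : nat) (S : set 'cV[R]_d)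
    (x : 'cV[R]_d) : set 'cV[R]_d :=
  closed_convex_hull ([set 0] `|` perp_directions S x).

(* R^n x R is identified with R^(n + 1), the pair (x, t) being
   [col_mx x t%:M]; [enorm] on R^(n + 1) is then the Euclidean product norm. *)
Definition epi (R : realType) (n : nat) (h : 'cV[R]_n -> \bar R) :
    set 'cV[R]_(n + 1) :=
  [set col_mx p.1 p.2%:M | p in [set p : 'cV[R]_n * R | (h p.1 <= p.2%:E)%E]].

Definition clarke_subdiff (R : realType) (n : nat) (h : 'cV[R]_n -> \bar R)
    (x : 'cV[R]_n) : set 'cV[R]_n :=
  [set xi | h x \is a fin_num /\
     clarke_normal_cone (epi h) (col_mx x (fine (h x))%:M)
       (col_mx xi (-1)%:M)].

Definition saddle_op (R : realType) (n m : nat)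
    (f : 'cV[R]_n -> \bar R) (f2 : 'cV[R]_n -> R)
    (g : 'cV[R]_m -> \bar R) (g2 : 'cV[R]_m -> R) (A : 'M[R]_(m, n))
    (z : 'cV[R]_n * 'cV[R]_m) : set ('cV[R]_n * 'cV[R]_m) :=
  [set xi + gradient f2 z.1 + A^T *m z.2 | xi in clarke_subdiff f z.1] `*`
  [set eta + gradient g2 z.2 - A *m z.1 | eta in clarke_subdiff g z.2].

Definition stationary (R : realType) (n m : nat)
    (T : 'cV[R]_n * 'cV[R]_m -> set ('cV[R]_n * 'cV[R]_m)) :
    set ('cV[R]_n * 'cV[R]_m) :=
  [set z | T z 0].

Definition weak_minty (R : realType) (n m : nat)
    (T : 'cV[R]_n * 'cV[R]_m -> set ('cV[R]_n * 'cV[R]_m))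
    (rho : R) (S : set ('cV[R]_n * 'cV[R]_m)) : Prop :=
  [/\ S !=set0, S `<=` stationary T &
      forall zs, S zs -> forall z v, T z v ->
        dotZ v (z - zs) >= rho * normZ v ^+ 2].

(* The iterates with a hat or a bar start at index 1: their values at index 0
   are unconstrained. *)
Definition nc_pdhg (R : realType) (n m : nat)
    (f : 'cV[R]_n -> \bar R) (f2 : 'cV[R]_n -> R)
    (g : 'cV[R]_m -> \bar R) (g2 : 'cV[R]_m -> R) (A : 'M[R]_(m, n))
    (gx gy alpha : R)
    (x xhat xbar : nat -> 'cV[R]_n) (y yhat ybar : nat -> 'cV[R]_m) : Prop :=
  forall k : nat,
    yhat k.+1 = y k + gy *: (A *m x k - gradient g2 (y k)) /\
    prox gy g (yhat k.+1) (ybar k.+1) /\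
    xhat k.+1 = x k - gx *: (gradient f2 (x k) + A^T *m ybar k.+1) /\
    prox gx f (xhat k.+1) (xbar k.+1) /\
    x k.+1 = x k + alpha *: (xbar k.+1 - xhat k.+1
      - gx *: (gradient f2 (xbar k.+1) + A^T *m ybar k.+1)) /\
    y k.+1 = y k + alpha *: (ybar k.+1 - yhat k.+1
      + gy *: (A *m xbar k.+1 - gradient g2 (ybar k.+1))).

Definition Dbar (R : realType) (n m : nat)
    (f2 : 'cV[R]_n -> R) (g2 : 'cV[R]_m -> R) (A : 'M[R]_(m, n)) (gx gy : R)
    (xhat xbar : nat -> 'cV[R]_n) (yhat ybar : nat -> 'cV[R]_m) (k : nat) :
    'cV[R]_n * 'cV[R]_m :=
  (gx^-1 *: (xhat k - xbar k) + gradient f2 (xbar k) + A^T *m ybar k,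
   gy^-1 *: (yhat k - ybar k) + gradient g2 (ybar k) - A *m xbar k).

(* Main.v *)
Require Import Defs.
From HB Require Import structures.
From mathcomp Require Import all_boot all_order all_algebra.
From mathcomp Require Import all_classical all_reals all_analysis.
From mathcomp Require Import ring lra.

Set Implicit Arguments.
Unset Strict Implicit.
Unset Printing Implicit Defensive.

Import Order.TTheory GRing.Theory Num.Theory.
Import numFieldNormedType.Exports.
Local Open Scope classical_set_scope.
Local Open Scope ring_scope.

(** The iteration is a relaxed forward step along the values of a set-valued
    operator, and the estimate comes from following the squared distance
    [V_k = sqnormZ_inv gx gy (z_k - zs)].

    Write [Db = (F, G)] for the vector [Dbar] of index [k + 1] and [zb] for
    [(xbar k.+1, ybar k.+1)].  The optimality of [zb] in the two proximal
    problems makes [Db] an element of the saddle operator at [zb]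
    ([Dbar_saddle_op]), and the last two lines of the algorithm say that
    [z_(k+1) = z_k - alpha * (gx * F, gy * G)].  Expanding the square gives
[[
    V_(k+1) = V_k - 2 alpha <Db, z_k - zs> + alpha^2 (gx |F|^2 + gy |G|^2),
    <Db, z_k - zs> = <Db, zb - zs> + <Db, z_k - zb>.
]]
    The first scalar product is at least [rho |Db|^2] by the weak Minty
    inequality.  The second is at least half of [gx |F|^2 + gy |G|^2]
    ([forward_gain]): by polarization this only says that
    [z_k - zb - (gx * F, gy * G)] is not longer than [z_k - zb], and the former
    vector is a difference of values of a single-valued map, which the step-size
    conditions make nonexpansive.  Hence [V_(k+1) <= V_k - 2 C |Db|^2]
    ([lyapunov_decrease]), with [C > 0], and the sum over [k] telescopes.

    The inclusion of the proximal residual in the Clarke subdifferential uses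
    only the geometric definition of normals: minimality in the proximal problem
    means that the epigraph stays outside of balls tangent at the proximal
    point, so that the residual, completed by the last coordinate -1, is normal
    to the epigraph there
    ([proximal_normal_clarke], [prox_clarke_subdiff]). *)

(** * Euclidean scalar product *)

Section Euclidean.
Variables (R : realType) (n : nat).
Implicit Types (u v w : 'cV[R]_n) (a : R).

Lemma dotvC u v : dotv u v = dotv v u.
Proof. by apply: eq_bigr => i _; rewrite mulrC. Qed.

Lemma dotvDl u v w : dotv (u + v) w = dotv u w + dotv v w.
Proof.
by rewrite /dotv -big_split; apply: eq_bigr => i _; rewrite mxE mulrDl.
Qed.

Lemma dotvZl a u w : dotv (a *: u) w = a * dotv u w.
Proof. by rewrite /dotv mulr_sumr; apply: eq_bigr => i _; rewrite mxE mulrA. Qed.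

Lemma dotvNl u w : dotv (- u) w = - dotv u w.
Proof. by rewrite -scaleN1r dotvZl mulN1r. Qed.

Lemma dotvDr u v w : dotv u (v + w) = dotv u v + dotv u w.
Proof. by rewrite dotvC dotvDl !(dotvC u). Qed.

Lemma dotvZr a u w : dotv u (a *: w) = a * dotv u w.
Proof. by rewrite dotvC dotvZl dotvC. Qed.

Lemma dotvNr u w : dotv u (- w) = - dotv u w.
Proof. by rewrite dotvC dotvNl dotvC. Qed.

Definition dotvE := (dotvDl, dotvDr, dotvNl, dotvNr, dotvZl, dotvZr).

Lemma dotvv_ge0 u : 0 <= dotv u u.
Proof. by apply: sumr_ge0 => i _; rewrite -expr2 sqr_ge0. Qed.

Lemma dotvv_eq0 u : (dotv u u == 0) = (u == 0).
Proof.
apply/idP/eqP => [/eqP u0|->]; last first.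
  by rewrite /dotv big1// => i _; rewrite mxE mul0r.
apply/colP => i; rewrite mxE; apply/eqP.
rewrite -sqrf_eq0 eq_le sqr_ge0 andbT -u0 /dotv (bigD1 i)//= -expr2 lerDl.
by apply: sumr_ge0 => j _; rewrite -expr2 sqr_ge0.
Qed.

Lemma dotvv_gt0 u : u != 0 -> 0 < dotv u u.
Proof. by rewrite -dotvv_eq0 lt_def dotvv_ge0 andbT. Qed.

Lemma sq_enorm u : enorm u ^+ 2 = dotv u u.
Proof. by rewrite sqr_sqrtr// dotvv_ge0. Qed.

Lemma enorm_ge0 u : 0 <= enorm u.
Proof. exact: sqrtr_ge0. Qed.

Lemma enorm_gt0 u : u != 0 -> 0 < enorm u.
Proof. by move=> u0; rewrite sqrtr_gt0 dotvv_gt0. Qed.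

Lemma enorm0 : enorm (0 : 'cV[R]_n) = 0.
Proof. by apply/eqP; rewrite -sqrf_eq0 sq_enorm dotvv_eq0. Qed.

Lemma enormZ a u : 0 <= a -> enorm (a *: u) = a * enorm u.
Proof.
move=> a0; rewrite /enorm dotvZl dotvZr mulrA -expr2 sqrtrM ?sqr_ge0//.
by rewrite sqrtr_sqr ger0_norm.
Qed.

Lemma cauchy_schwarz u v : dotv u v ^+ 2 <= dotv u u * dotv v v.
Proof.
have [->|u0] := eqVneq u 0.
  have z w : dotv 0 w = 0 by rewrite -(scale0r 0) dotvZl mul0r.
  by rewrite !z expr0n mul0r.
(* The square of the length of the component of [v] orthogonal to [u], up to
   the factor [dotv u u]. *)
have := dotvv_ge0 (dotv u u *: v - dotv u v *: u).
rewrite !dotvE !(dotvC v u) => h.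
rewrite -subr_ge0 -(pmulr_rge0 _ (dotvv_gt0 u0)).
by apply: le_trans h _; rewrite le_eqVlt; apply/orP; left; apply/eqP; ring.
Qed.

End Euclidean.

Lemma sq_normZ (R : realType) (n m : nat) (z : 'cV[R]_n * 'cV[R]_m) :
  normZ z ^+ 2 = dotv z.1 z.1 + dotv z.2 z.2.
Proof. by rewrite sqr_sqrtr ?addr_ge0 ?sqr_ge0// !sq_enorm. Qed.

Lemma dotv_col_mx (R : realType) (n m : nat)
    (a c : 'cV[R]_n) (b d : 'cV[R]_m) :
  dotv (col_mx a b) (col_mx c d) = dotv a c + dotv b d.
Proof.
rewrite /dotv big_split_ord /=; congr (_ + _).
  by apply: eq_bigr => i _; rewrite !col_mxEu.
by apply: eq_bigr => i _; rewrite !col_mxEd.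
Qed.

Lemma dotv_scalar (R : realType) (s t : R) :
  dotv (s%:M : 'cV[R]_1) t%:M = s * t.
Proof. by rewrite /dotv big_ord1 !mxE eqxx !mulr1n. Qed.

(** The Frobenius norm of [A] bounds the set of which [opnorm A] is the
    supremum, so that this supremum is a genuine upper bound; the rest is
    homogeneity. *)
Lemma enorm_mulmx_le (R : realType) (n m : nat) (A : 'M[R]_(m, n))
    (u : 'cV[R]_n) :
  enorm (A *m u) <= opnorm A * enorm u.
Proof.
have row_dot w i : (A *m w) i 0 = dotv (row i A)^T w.
  by rewrite mxE; apply: eq_bigr => j _; rewrite !mxE.
set B := \sum_i dotv (row i A)^T (row i A)^T.
have frobenius w : dotv (A *m w) (A *m w) <= B * dotv w w.
  rewrite mulr_suml; apply: ler_sum => i _.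
  by rewrite -expr2 row_dot cauchy_schwarz.
have ub : has_ubound [set enorm (A *m u) | u in [set u | enorm u <= 1]].
  exists (Num.sqrt B) => _ [w /= w1 <-]; rewrite ler_wsqrtr//.
  apply: le_trans (frobenius w) _; rewrite ler_piMr//.
    by apply: sumr_ge0 => i _; apply: dotvv_ge0.
  by rewrite -sq_enorm expr_le1// enorm_ge0.
have [->|u0] := eqVneq u 0.
  by rewrite mulmx0 !enorm0 mulr0.
have nu := enorm_gt0 u0.
rewrite -ler_pdivrMr//; apply: (ub_le_sup ub).
exists ((enorm u)^-1 *: u) => /=.
  by rewrite enormZ ?invr_ge0 ?enorm_ge0// mulVf// gt_eqF.
by rewrite -scalemxAr enormZ ?invr_ge0 ?enorm_ge0// mulrC.
Qed.

(** * Proximal normals and the Clarke subdifferential *)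

(** The hypothesis says that [S] avoids the open ball of radius [s |w|] centred
    at [p + s w].  Hence [p] is the only closest point of [S] to [p + t w] for
    all small [t], and [w] is already the direction of perpendicular vectors at
    the single base point [p]. *)
Lemma proximal_normal_clarke (R : realType) (d : nat) (S : set 'cV[R]_d)
    (p w : 'cV[R]_d) (s : R) :
  0 < s -> S p ->
  (forall q, S q -> dotv w (q - p) <= (2 * s)^-1 * enorm (q - p) ^+ 2) ->
  clarke_normal_cone S p w.
Proof.
move=> s0 Sp prox_ineq.
suff w_gen : ([set 0] `|` perp_directions S p) w.
  by apply: subset_closure; exact: sub_gen_smallest.
have [->|w0] := eqVneq w 0; first by left.
right.
have nearest t q : 0 < t < s -> S q -> q != p ->
    enorm (t *: w) < enorm (p + t *: w - q).
  move=> /andP[t0 ts] Sq qp.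
  suff lt_sq : dotv (t *: w) (t *: w) < dotv (p + t *: w - q) (p + t *: w - q).
    by rewrite /enorm ltr_sqrt// (le_lt_trans (dotvv_ge0 _) lt_sq).
  have := prox_ineq q Sq; rewrite sq_enorm.
  have : 0 < dotv (q - p) (q - p) by rewrite dotvv_gt0// subr_eq0.
  have -> : p + t *: w - q = t *: w - (q - p) by rewrite opprB addrCA addrA.
  move: (q - p) => r r0 wr.
  have twr : t * dotv w r <= t * ((2 * s)^-1 * dotv r r) by rewrite ler_pM2l.
  have ts_r : t * ((2 * s)^-1 * dotv r r) < 2^-1 * dotv r r.
    by rewrite mulrA ltr_pM2r// invfM mulrCA gtr_pMr// ltr_pdivrMr// mul1r.
  by rewrite !dotvE (dotvC r w); lra.
(* Any positive sequence below [s] that tends to 0 would do. *)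
pose t i : R := s / 2 * harmonic i.
have t_bounds i : 0 < t i < s.
  rewrite mulr_gt0 ?divr_gt0 ?invr_gt0 ?ltr0n//=.
  apply: (@le_lt_trans _ _ (s / 2)); last by lra.
  by rewrite ler_piMr ?divr_ge0 ?(ltW s0)//= invf_le1 ?ler1n ?ltr0n.
have nw := enorm_gt0 w0.
exists (enorm w), ((enorm w)^-1 *: w), (fun=> p), (fun i => t i *: w); split.
- by rewrite enorm_ge0 scalerA divff ?scale1r// gt_eqF.
- move=> i; split=> //.
  have /andP[ti0 tis] := t_bounds i.
  have tw0 : t i *: w != 0 by rewrite scaler_eq0 negb_or w0 gt_eqF.
  split=> //; exists (p + t i *: w).
  have addK : p + t i *: w - p = t i *: w by rewrite addrC addKr.
  split=> //.
    move=> /(nearest (t i) _ (t_bounds i)).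
    rewrite -subr_eq0 addK subrr => /(_ tw0).
    by rewrite enorm0 ltNge enorm_ge0.
  by move=> q Sq qp; rewrite addK nearest.
- exact: cvg_cst.
- rewrite -[X in _ --> X](scale0r w); apply: cvgZl.
  rewrite -[X in _ --> X](mulr0 (s / 2)); apply: cvgMr.
  exact: cvg_harmonic.
- have -> : (fun i => (enorm (t i *: w))^-1 *: (t i *: w)) =
            (fun=> (enorm w)^-1 *: w).
    apply/funext => i; have /andP[ti0 _] := t_bounds i.
    rewrite enormZ ?ltW// scalerA invfM mulrAC mulVf ?gt_eqF//.
    by rewrite mul1r.
  exact: cvg_cst.
Qed.

(** Minimality of [ub] compares [h] with a concave paraboloid touching it from
    below at [ub], with slope [s^-1 *: (u - ub)]; read in the epigraph this is
    the proximal-normal inequality of [proximal_normal_clarke]. *)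
Lemma prox_clarke_subdiff (R : realType) (n : nat) (h : 'cV[R]_n -> \bar R)
    (s : R) (u ub : 'cV[R]_n) :
  proper_function h -> 0 < s -> prox s h u ub ->
  clarke_subdiff h ub (s^-1 *: (u - ub)).
Proof.
move=> [hNy [v0 hv0]] s0 min_ub.
have finh : h ub \is a fin_num.
  rewrite fin_numE hNy /=; apply/eqP => hy.
  have := min_ub v0; rewrite hy.
  by case: (h v0) (hNy v0) hv0.
have paraboloid v r : (h v <= r%:E)%E ->
    fine (h ub) + (2 * s)^-1 * enorm (ub - u) ^+ 2 <=
      r + (2 * s)^-1 * enorm (v - u) ^+ 2.
  move=> hvr; rewrite -lee_fin !EFinD fineK//.
  by apply: le_trans (min_ub v) _; rewrite leeD2r.
split=> //; apply: (proximal_normal_clarke s0).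
  by exists (ub, fine (h ub)) => //=; rewrite fineK.
move=> _ [[v r] /= /paraboloid ineq <-].
rewrite opp_col_mx add_col_mx -raddfB /= sq_enorm !dotv_col_mx !dotv_scalar.
move: ineq; rewrite !sq_enorm.
have -> : v - u = (v - ub) + (ub - u) by rewrite addrA subrK.
have -> : u - ub = - (ub - u) by rewrite opprB.
move: (v - ub) (ub - u) (fine (h ub)) => e c a.
rewrite !dotvE (dotvC e c) => ineq.
have e2 : (2 * s)^-1 = s^-1 / 2 by rewrite invfM mulrC.
(* The squared distance in the epigraph exceeds the horizontal one by the square
   of the vertical displacement. *)
have := mulr_ge0 (ltW (_ : 0 < (2 * s)^-1)) (sqr_ge0 (r - a)).
rewrite invr_gt0 mulr_gt0// => /(_ isT).
by move: ineq; rewrite e2; lra.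
Qed.

(** * One iteration *)

(** Polarization: a vector of the form [s^-1 *: (d - e)] correlates with [d] as
    soon as [e] is not longer than [d]. *)
Lemma dotv_residual (R : realType) (n : nat) (s : R) (d e : 'cV[R]_n) :
  0 < s ->
  2 * dotv (s^-1 *: (d - e)) d =
    s * dotv (s^-1 *: (d - e)) (s^-1 *: (d - e))
    + s^-1 * dotv d d - s^-1 * dotv e e.
Proof.
by move=> s0; rewrite !dotvE (dotvC e d); field; rewrite gt_eqF.
Qed.

(** The vectors [ex] and [ey] are what the single-valued forward part of the
    algorithm does to the displacement [(dx, dy)]; the factors 2 in the two
    step-size conditions come from splitting the square of the sum in [ey]. *)
Lemma forward_nonexpansive (R : realType) (n m : nat) (A : 'M[R]_(m, n))
    (Lf2 Lg2 gx gy : R) (dx p : 'cV[R]_n) (dy q : 'cV[R]_m) :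
  0 <= Lf2 -> 0 <= Lg2 -> 0 < gx -> 0 < gy ->
  enorm p <= Lf2 * enorm dx -> enorm q <= Lg2 * enorm dy ->
  (Lg2 != 0 -> gy <= 1 / (Num.sqrt 2 * Lg2)) ->
  2 * gx * gy * opnorm A ^+ 2 + gx ^+ 2 * Lf2 ^+ 2 <= 1 ->
  forall ex ey, ex = gx *: p -> ey = gy *: (q - A *m dx) ->
  gx^-1 * dotv ex ex + gy^-1 * dotv ey ey
    <= gx^-1 * dotv dx dx + gy^-1 * dotv dy dy.
Proof.
move=> Lf0 Lg0 gx0 gy0 pL qL gyL gxyL ex ey -> ->.
have sq_le k l (a : 'cV[R]_k) (b : 'cV[R]_l) L :
    enorm a <= L * enorm b -> dotv a a <= L ^+ 2 * dotv b b.
  move=> ab; rewrite -!sq_enorm -exprMn ler_pXn2r ?nnegrE ?enorm_ge0//.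
  exact: le_trans (enorm_ge0 _) ab.
have {}pL := sq_le _ _ _ _ _ pL.
have {}qL := sq_le _ _ _ _ _ qL.
have AL := sq_le _ _ _ _ _ (enorm_mulmx_le A dx).
have {}gyL : 2 * gy ^+ 2 * Lg2 ^+ 2 <= 1.
  have [->|Lg_neq0] := eqVneq Lg2 0; first by rewrite expr0n mulr0 ler01.
  have Lg_gt0 : 0 < Lg2 by rewrite lt_def Lg_neq0.
  have r2 : 0 < Num.sqrt 2 :> R by rewrite sqrtr_gt0.
  have := gyL Lg_neq0; rewrite ler_pdivlMr ?mulr_gt0// => le1.
  have -> : 2 * gy ^+ 2 * Lg2 ^+ 2 = (gy * (Num.sqrt 2 * Lg2)) ^+ 2.
    by rewrite !exprMn sqr_sqrtr//; ring.
  by rewrite expr_le1// !mulr_ge0// ltW.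
have split2 : dotv (q - A *m dx) (q - A *m dx)
    <= 2 * dotv q q + 2 * dotv (A *m dx) (A *m dx).
  have := dotvv_ge0 (q + A *m dx).
  by rewrite !dotvE (dotvC (A *m dx) q); lra.
have -> : gx^-1 * dotv (gx *: p) (gx *: p) = gx^-1 * (gx ^+ 2 * dotv p p).
  by rewrite !dotvE; ring.
have -> : gy^-1 * dotv (gy *: (q - A *m dx)) (gy *: (q - A *m dx)) =
    gy^-1 * (gy ^+ 2 * dotv (q - A *m dx) (q - A *m dx)).
  by rewrite dotvZl dotvZr; ring.
have dx0 := dotvv_ge0 dx; have dy0 := dotvv_ge0 dy.
set P := dotv p p in pL *; set Q := dotv q q in qL split2 *.
set M := dotv (A *m dx) _ in AL split2; set N := dotv (q - _) _ in split2 *.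
set X := dotv dx dx in pL AL dx0 *; set Y := dotv dy dy in qL dy0 *.
apply: (@le_trans _ _ (gx^-1 * ((2 * gx * gy * opnorm A ^+ 2
    + gx ^+ 2 * Lf2 ^+ 2) * X) + gy^-1 * (2 * gy ^+ 2 * Lg2 ^+ 2 * Y))).
  have -> : gx^-1 * ((2 * gx * gy * opnorm A ^+ 2 + gx ^+ 2 * Lf2 ^+ 2) * X)
      + gy^-1 * (2 * gy ^+ 2 * Lg2 ^+ 2 * Y) =
      gx^-1 * (gx ^+ 2 * (Lf2 ^+ 2 * X))
      + gy^-1 * (gy ^+ 2 * (2 * (Lg2 ^+ 2 * Y) + 2 * (opnorm A ^+ 2 * X))).
    by field; rewrite !gt_eqF.
  apply: lerD; rewrite ler_pM2l ?invr_gt0// ler_pM2l ?exprn_gt0//.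
  by apply: le_trans split2 _; lra.
by apply: lerD; rewrite ler_pM2l ?invr_gt0// ler_piMl.
Qed.

(** With [(dx, dy) = z_k - zb], the vectors [F] and [G] are the two components
    of [Dbar]: eliminating the points with a hat gives them the form required by
    [dotv_residual], in which the forward part is nonexpansive. *)
Lemma forward_gain (R : realType) (n m : nat) (A : 'M[R]_(m, n))
    (Lf2 Lg2 gx gy : R) (dx p : 'cV[R]_n) (dy q : 'cV[R]_m) :
  0 <= Lf2 -> 0 <= Lg2 -> 0 < gx -> 0 < gy ->
  enorm p <= Lf2 * enorm dx -> enorm q <= Lg2 * enorm dy ->
  (Lg2 != 0 -> gy <= 1 / (Num.sqrt 2 * Lg2)) ->
  2 * gx * gy * opnorm A ^+ 2 + gx ^+ 2 * Lf2 ^+ 2 <= 1 ->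
  forall F G, F = gx^-1 *: (dx - gx *: p) ->
  G = gy^-1 *: (dy - gy *: (q - A *m dx)) ->
  gx * dotv F F + gy * dotv G G <= 2 * (dotv F dx + dotv G dy).
Proof.
move=> Lf0 Lg0 gx0 gy0 pL qL gyL gxyL F G -> ->.
have := forward_nonexpansive Lf0 Lg0 gx0 gy0 pL qL gyL gxyL erefl erefl.
by rewrite mulrDr !dotv_residual//; lra.
Qed.

Lemma sqnormZ_inv_ge0 (R : realType) (n m : nat) (gx gy : R)
    (z : 'cV[R]_n * 'cV[R]_m) :
  0 < gx -> 0 < gy -> 0 <= sqnormZ_inv gx gy z.
Proof.
move=> /ltW gx0 /ltW gy0; rewrite /sqnormZ_inv.
by apply: addr_ge0; apply: mulr_ge0; rewrite ?invr_ge0 ?sqr_ge0.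
Qed.

Lemma Dbar_saddle_op (R : realType) (n m : nat)
    (f : 'cV[R]_n -> \bar R) (f2 : 'cV[R]_n -> R)
    (g : 'cV[R]_m -> \bar R) (g2 : 'cV[R]_m -> R) (A : 'M[R]_(m, n))
    (gx gy : R) (xhat xbar : nat -> 'cV[R]_n) (yhat ybar : nat -> 'cV[R]_m)
    (k : nat) :
  proper_function f -> proper_function g -> 0 < gx -> 0 < gy ->
  prox gx f (xhat k) (xbar k) -> prox gy g (yhat k) (ybar k) ->
  saddle_op f f2 g g2 A (xbar k, ybar k)
    (Dbar f2 g2 A gx gy xhat xbar yhat ybar k).
Proof.
move=> f_proper g_proper gx0 gy0 prox_f prox_g; split => /=.
  by exists (gx^-1 *: (xhat k - xbar k)) => //; apply: prox_clarke_subdiff.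
by exists (gy^-1 *: (yhat k - ybar k)) => //; apply: prox_clarke_subdiff.
Qed.

(** The bookkeeping of one relaxed step [z - alpha * (gx * F, gy * G)]: the
    gain along [z - zb] exceeds the quadratic cost by the factor [1 - alpha] and
    pays for a possibly negative [rho]. *)
Lemma lyapunov_decrease (R : realType) (n m : nat) (gx gy alpha rho : R)
    (z zb zs D : 'cV[R]_n * 'cV[R]_m) :
  0 < gx -> 0 < gy -> 0 < alpha -> alpha <= 1 ->
  gx * dotv D.1 D.1 + gy * dotv D.2 D.2 <= 2 * dotZ D (z - zb) ->
  rho * normZ D ^+ 2 <= dotZ D (zb - zs) ->
  sqnormZ_inv gx gy ((z.1 - (alpha * gx) *: D.1, z.2 - (alpha * gy) *: D.2) - zs)
    <= sqnormZ_inv gx gy (z - zs)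
       - 2 * (alpha * (Num.min gx gy * (1 - alpha) / 2 + rho)) * normZ D ^+ 2.
Proof.
case: z zb zs D => [x y] [xb yb] [xs ys] [F G] /= gx0 gy0 a0 a1.
rewrite sq_normZ /dotZ /sqnormZ_inv /= !sq_enorm.
have -> : x - (alpha * gx) *: F - xs = (x - xs) - (alpha * gx) *: F.
  by rewrite addrAC.
have -> : y - (alpha * gy) *: G - ys = (y - ys) - (alpha * gy) *: G.
  by rewrite addrAC.
have -> : xb - xs = (x - xs) - (x - xb) by rewrite opprB [RHS]addrC subrKA.
have -> : yb - ys = (y - ys) - (y - yb) by rewrite opprB [RHS]addrC subrKA.
move: (x - xs) (x - xb) (y - ys) (y - yb) => u d v e gain minty.
have expand k s (a b : 'cV[R]_k) : 0 < s ->
    s^-1 * dotv (a - (alpha * s) *: b) (a - (alpha * s) *: b) =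
    s^-1 * dotv a a - 2 * alpha * dotv b a + alpha ^+ 2 * (s * dotv b b).
  by move=> s0; rewrite !dotvE (dotvC b a); field; rewrite gt_eqF.
rewrite !expand//; move: minty; rewrite !dotvDr !dotvNr => minty.
have minN : Num.min gx gy * (dotv F F + dotv G G)
    <= gx * dotv F F + gy * dotv G G.
  by rewrite mulrDr lerD// ler_wpM2r ?dotvv_ge0// ge_min lexx ?orbT.
set N := gx * _ + _ in gain minN; set n2 := dotv F F + _ in minty minN *.
have h1 : alpha * (rho * n2) <= alpha * (dotv F u - dotv F d
    + (dotv G v - dotv G e)) by rewrite ler_pM2l.
have h2 : alpha * N <= alpha * (2 * (dotv F d + dotv G e)) by rewrite ler_pM2l.
have h3 : alpha * (1 - alpha) * (Num.min gx gy * n2) <= alpha * (1 - alpha) * N.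
  by rewrite ler_wpM2l// mulr_ge0 ?subr_ge0// ltW.
have -> : gx^-1 * dotv u u - 2 * alpha * dotv F u + alpha ^+ 2 * (gx * dotv F F)
    + (gy^-1 * dotv v v - 2 * alpha * dotv G v + alpha ^+ 2 * (gy * dotv G G)) =
    gx^-1 * dotv u u + gy^-1 * dotv v v
    - 2 * (alpha * (dotv F u + dotv G v)) + alpha ^+ 2 * N.
  by rewrite /N; ring.
lra.
Qed.

(** * The summed estimate *)


Theorem theorem1 (R : realType) (n m : nat)
    (f : 'cV[R]_n -> \bar R) (f2 : 'cV[R]_n -> R)
    (g : 'cV[R]_m -> \bar R) (g2 : 'cV[R]_m -> R) (A : 'M[R]_(m, n))
    (Lf2 Lg2 : R)
    (f_proper : proper_function f) (f_lsc : lower_semicontinuous f)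
    (g_proper : proper_function g) (g_lsc : lower_semicontinuous g)
    (f2_diff : forall x, differentiable f2 x)
    (g2_diff : forall y, differentiable g2 y)
    (Lf2_ge0 : 0 <= Lf2) (Lg2_ge0 : 0 <= Lg2)
    (f2_lip : elipschitz Lf2 (gradient f2))
    (g2_lip : elipschitz Lg2 (gradient g2))
    (rho : R) (Sstar : set ('cV[R]_n * 'cV[R]_m))
    (wmvi : weak_minty (saddle_op f f2 g g2 A) rho Sstar)
    (zs : 'cV[R]_n * 'cV[R]_m) (zs_in : Sstar zs)
    (gx gy alpha : R) (gx_gt0 : 0 < gx) (gy_gt0 : 0 < gy)
    (alpha_gt0 : 0 < alpha) (alpha_le1 : alpha <= 1)
    (alpha_lt : alpha < 1 + 2 * rho / Num.min gx gy)
    (gy_le : Lg2 != 0 -> gy <= 1 / (Num.sqrt 2 * Lg2))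
    (gxgy_le : 2 * gx * gy * opnorm A ^+ 2 + gx ^+ 2 * Lf2 ^+ 2 <= 1)
    (x xhat xbar : nat -> 'cV[R]_n) (y yhat ybar : nat -> 'cV[R]_m)
    (prox_g_nonempty : forall k, prox gy g (yhat k.+1) !=set0)
    (prox_f_nonempty : forall k, prox gx f (xhat k.+1) !=set0)
    (alg : nc_pdhg f f2 g g2 A gx gy alpha x xhat xbar y yhat ybar) :
  let C := alpha * (Num.min gx gy * (1 - alpha) / 2 + rho) in
  forall K : nat, (1 <= K)%N ->
    \sum_(0 <= k < K) normZ (Dbar f2 g2 A gx gy xhat xbar yhat ybar k.+1) ^+ 2
      <= sqnormZ_inv gx gy ((x 0%N, y 0%N) - zs) / (2 * C).
Proof.
set z := fun k => (x k, y k).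
set D := Dbar f2 g2 A gx gy xhat xbar yhat ybar.
move=> C K _.
have min_gt0 : 0 < Num.min gx gy by rewrite lt_min gx_gt0.
have C_gt0 : 0 < C.
  rewrite mulr_gt0//.
  move: alpha_lt; rewrite -ltrBlDl ltr_pdivlMr//.
  by move: (Num.min gx gy) => s; lra.
have [_ _ /(_ zs zs_in) minty] := wmvi.
have decrease k : sqnormZ_inv gx gy (z k.+1 - zs)
    <= sqnormZ_inv gx gy (z k - zs) - 2 * C * normZ (D k.+1) ^+ 2.
  have [yhE [prox_g [xhE [prox_f [xE yE]]]]] := alg k.
  have step : z k.+1 = ((z k).1 - (alpha * gx) *: (D k.+1).1,
                        (z k).2 - (alpha * gy) *: (D k.+1).2).
    congr (_, _); rewrite ?xE ?yE /=.
      move: (gradient _ _) (A^T *m _) => p q.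
      by apply/colP => i; rewrite !mxE; field; rewrite gt_eqF.
    move: (gradient _ _) (A *m _) => p q.
    by apply/colP => i; rewrite !mxE; field; rewrite gt_eqF.
  rewrite step; apply: (lyapunov_decrease (zb := (xbar k.+1, ybar k.+1))) => //.
    apply: (forward_gain Lf2_ge0 Lg2_ge0 gx_gt0 gy_gt0
      (f2_lip (x k) (xbar k.+1)) (g2_lip (y k) (ybar k.+1)) gy_le gxgy_le).
      rewrite /= xhE; move: (gradient _ _) (gradient _ _) (A^T *m _) => p q r.
      by apply/colP => i; rewrite !mxE; field; rewrite gt_eqF.
    rewrite /= yhE mulmxBr.
    move: (gradient _ _) (gradient _ _) (A *m _) (A *m _) => p q r r'.
    by apply/colP => i; rewrite !mxE; field; rewrite gt_eqF.
  exact/minty/Dbar_saddle_op.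
have sum_le : 2 * C * \sum_(0 <= k < K) normZ (D k.+1) ^+ 2
    <= sqnormZ_inv gx gy (z 0%N - zs) - sqnormZ_inv gx gy (z K - zs).
  pose V k := sqnormZ_inv gx gy (z k - zs).
  rewrite mulr_sumr -opprB -(telescope_sumr V)//.
  rewrite -sumrN; apply: ler_sum => k _.
  by have := decrease k; rewrite /V; lra.
have C2_gt0 : 0 < 2 * C by apply: mulr_gt0.
rewrite (ler_pdivlMr _ _ C2_gt0) mulrC.
apply: le_trans sum_le _.
by rewrite gerBl sqnormZ_inv_ge0.
Qed.
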